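(* If $W$ is a weakly random graphon such that there exists a finite graph $G$ with $\phi_W(G)=0$, then $W$ is a.e. $\{0,1\}$-valued.
   Context: A graphon is a symmetric measurable $W\colon X\times X\to[0,1]$ on an atomless standard probability space $(X,\mathcal{A},\mu)$; $\phi_W(G)$ is the induced density $\frac{|G|!}{|\mathrm{Aut}(G)|}\int\prod_{\{v,w\}\in E(G)}W(x_v,x_w)\prod_{\{v,w\}\notin E(G)}(1-W(x_v,x_w))\,d\mu(x)$. A subgraphon of $W$ is $W$ considered on the space $(X,\mu_f)$ with $\mu_f(B)=\int_Bf\,d\mu/\int f\,d\mu$ for a measurable $f\colon X\to[0,1]$ with $\int f>0$. $Q(W)$ is the set of finite graphs $G$ with $\phi_W(G)>0$; $W$ is weakly random if $Q(W')=Q(W)$ for every subgraphon $W'$. *)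

(* Defs.v *)
From HB Require Import structures.
From mathcomp Require Import all_boot all_order all_algebra all_fingroup.
From mathcomp Require Import all_classical all_reals all_analysis.
From mathcomp Require Import measurable_realfun.

Set Implicit Arguments.
Unset Strict Implicit.
Unset Printing Implicit Defensive.

Import Order.TTheory GRing.Theory Num.Theory.
Import numFieldNormedType.Exports.

Local Open Scope classical_set_scope.
Local Open Scope ring_scope.

Record finite_graph := FiniteGraph {
  vertex :> finType;
  adj : rel vertex;
  adj_sym : symmetric adj;
  adj_irr : irreflexive adj }.

Definition is_aut (G : finite_graph) (s : {perm G}) : bool :=
  [forall v, forall w, adj (s v) (s w) == adj v w].

Definition nb_aut (G : finite_graph) : nat := #|[set s : {perm G} | is_aut s]|.

(** [X] is Borel-isomorphic to a Polish space [T], i.e. to a complete separable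
    metric space (a pseudometric space is metric iff it is Hausdorff) with its
    Borel sigma-algebra. *)
Definition standard_borel (R : realType) d (X : measurableType d) : Prop :=
  exists (T : completePseudoMetricType R) (h : X -> T),
    [/\ hausdorff_space T,
        exists2 D : set T, countable D & dense D,
        bijective h &
        forall A : set T, <<s @open T >> A <-> measurable (h @^-1` A)].

Definition atomless (R : realType) d (X : measurableType d)
    (mu : probability X R) : Prop :=
  forall A, measurable A -> (0 < mu A)%E ->
    exists B, [/\ measurable B, B `<=` A, (0 < mu B)%E & (mu B < mu A)%E].

Definition is_graphon (R : realType) d (X : measurableType d)
    (mu : probability X R) (W : X * X -> R) : Prop :=
  [/\ standard_borel R X, atomless mu, measurable_fun setT W,
      forall x y, W (x, y) = W (y, x) & forall p, 0 <= W p <= 1].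

Section power_measure.
Context (d : measure_display) (X : measurableType d) (R : realType).
Variable mu : probability X R.

Definition tcons n (p : X * n.-tuple X) : n.+1.-tuple X :=
  [the n.+1.-tuple X of p.1 :: p.2].

Lemma measurable_tcons n : measurable_fun setT (@tcons n).
Proof. exact: measurable_cons. Qed.

HB.instance Definition _ n := isMeasurableFun.Build _ _ _ _ (@tcons n)
  (@measurable_tcons n).

(** The product measure on [X ^ n]: the image of [mu \x power_measure n.-1]
    under the identification of [X * X ^ n.-1] with [X ^ n]. *)
Fixpoint power_measure n : probability (n.-tuple X) R :=
  match n with
  | 0 => dirac [tuple]
  | m.+1 => distribution (mu \x power_measure m)%E (@tcons m)
  end.

End power_measure.

(** The vertices of [G] are listed as [enum_val i], [i : 'I_#|G|], so that each
    unordered pair of distinct vertices corresponds to one pair [i < j]. *)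
Definition induced_factor (R : realType) (X : Type) (W : X * X -> R)
    (G : finite_graph) (x : #|G|.-tuple X) : R :=
  \prod_(i < #|G|) \prod_(j < #|G| | (i < j)%N)
    let w := W (tnth x i, tnth x j) in
    if adj (enum_val i : G) (enum_val j) then w else 1 - w.

Definition phi (R : realType) d (X : measurableType d) (mu : probability X R)
    (W : X * X -> R) (G : finite_graph) : \bar R :=
  (((#|G| `!)%:R / (nb_aut G)%:R)%R%:E *
    \int[power_measure mu #|G|]_x (induced_factor W x)%:E)%E.

(** The set of finite graphs of positive density, as a predicate: [finite_graph]
    lives in too large a universe for [set finite_graph]. *)
Definition Q (R : realType) d (X : measurableType d) (mu : probability X R)
    (W : X * X -> R) (G : finite_graph) : Prop :=
  (0 < phi mu W G)%E.

Record weight (R : realType) d (X : measurableType d) (mu : probability X R) :=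
  Weight {
  weight_fun :> X -> R;
  weight_meas : measurable_fun setT weight_fun;
  weight_range : forall x, 0 <= weight_fun x <= 1;
  weight_pos : (0 < \int[mu]_x (weight_fun x)%:E)%E }.

Section weighted.
Context (R : realType) (d : measure_display) (X : measurableType d).
Variables (mu : probability X R) (f : weight mu).
Local Open Scope ereal_scope.

Definition weighted (B : set X) : \bar R :=
  \int[mu]_(x in B) (f x)%:E * ((fine (\int[mu]_x (f x)%:E))^-1)%:E.

Let meas_f : measurable_fun setT (fun x : X => (f x)%:E).
Proof. by apply/measurable_EFinP; exact: weight_meas. Qed.

Let f_ge0 x : 0 <= (f x)%:E.
Proof. by rewrite lee_fin; case/andP: (weight_range f x). Qed.

Let total_fin : \int[mu]_x (f x)%:E \is a fin_num.
Proof.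
rewrite ge0_fin_numE; last exact: integral_ge0.
apply: (@le_lt_trans _ _ (\int[mu]_x (cst 1 x))).
  apply: ge0_le_integral => //.
  by move=> x _; rewrite lee_fin; case/andP: (weight_range f x).
by rewrite integral_cst// mul1e -ge0_fin_numE// fin_num_measure.
Qed.

Let weighted0 : weighted set0 = 0.
Proof. by rewrite /weighted integral_set0 mul0e. Qed.

Let weighted_ge0 B : 0 <= weighted B.
Proof.
rewrite /weighted mule_ge0 ?integral_ge0// lee_fin invr_ge0 fine_ge0//.
exact: integral_ge0.
Qed.

Let weighted_sigma_additive : semi_sigma_additive weighted.
Proof.
move=> F mF tF mUF; rewrite /weighted.
rewrite [X in X @ _ --> _](_ : _ = (fun n =>
    (\sum_(0 <= i < n) \int[mu]_(x in F i) (f x)%:E) *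
    ((fine (\int[mu]_x (f x)%:E))^-1)%:E)); last first.
  apply/funext => n; rewrite ge0_sume_distrl// => i _; exact: integral_ge0.
apply: cvgeZr => //.
exact: (semi_sigma_additive_nng_induced meas_f f_ge0).
Qed.

HB.instance Definition _ := isMeasure.Build _ _ _ weighted
  weighted0 weighted_ge0 weighted_sigma_additive.

Let weighted_setT : weighted setT = 1.
Proof.
rewrite /weighted -{1}(fineK total_fin) -EFinM divff// fine_eq0//.
by rewrite gt_eqF// weight_pos.
Qed.

HB.instance Definition _ := Measure_isProbability.Build _ _ _ weighted
  weighted_setT.

End weighted.

Definition weakly_random (R : realType) d (X : measurableType d)
    (mu : probability X R) (W : X * X -> R) : Prop :=
  forall (f : weight mu) (G : finite_graph), Q (weighted f) W G <-> Q mu W G.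

(* Main.v *)
Require Import Defs.
From HB Require Import structures.
From mathcomp Require Import all_boot all_order all_algebra all_fingroup.
From mathcomp Require Import all_classical all_reals all_analysis.
From mathcomp Require Import measurable_realfun.

Set Implicit Arguments.
Unset Strict Implicit.
Unset Printing Implicit Defensive.

Import numFieldNormedType.Exports.
Import Order.TTheory GRing.Theory Num.Theory.

Local Open Scope classical_set_scope.
Local Open Scope ring_scope.

(** Suppose [S = {0 < W < 1}] is not null. Every graph [G] then has positive
    density, by induction on the number of vertices. By Fubini, the section
    [S_y] has positive measure for a non-null set of points [y]. Remove a vertex
    [v] from [G]: by induction [G - v] has positive density in [W], hence, by weak
    randomness, also in the subgraphon given by the indicator of [S_y]. A copy of
    [G - v] inside [S_y] extends by [y] to a copy of [G], whatever the
    neighbourhood of [v], since the new factors [W(y, .)] and [1 - W(y, .)] do not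
    vanish on [S_y]. *)

(** * Null sets of integrals and of product measures *)

Lemma ge0_integral_eq0P (R : realType) d (T : measurableType d)
    (m : {measure set T -> \bar R}) (D : set T) (f : T -> \bar R) :
  measurable D -> measurable_fun D f -> (forall x, 0 <= f x)%E ->
  (\int[m]_(x in D) f x = 0)%E <-> m (D `&` [set x | f x != 0%E]) = 0%E.
Proof.
move=> mD mf f0.
have mE : measurable (D `&` [set x | f x != 0%E]) by exact: emeasurable_neq.
under eq_integral do rewrite -(gee0_abs (f0 _)).
apply: (iff_trans (ae_eq_integral_abs m mD mf)).
(* The a.e. statement asks for a null set containing the points where [D x -> f x = 0] fails; these
   are the points of [D] with [f x != 0]. *)
have DE : D `&` [set x | f x != 0%E] = ~` [set x | D x -> f x = cst 0%E x].
  apply/seteqP; split=> [x [Dx /eqP fx] /(_ Dx)//|x /= fx].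
  have [Dx|nDx] := pselect (D x); last by exfalso; apply: fx.
  by split=> //; apply/eqP => fx0; apply: fx.
split=> [[N [mN N0]]|m0].
  by rewrite -DE => sub; exact: (subset_measure0 mE mN sub N0).
by exists (D `&` [set x | f x != 0%E]); split=> //; rewrite -DE.
Qed.

Section product_null.
Context (R : realType) d1 (T1 : measurableType d1) d2 (T2 : measurableType d2).
Variables (m1 : probability T1 R) (m2 : probability T2 R).

Lemma measurable_xsection_neq0 (A : set (T1 * T2)) : measurable A ->
  measurable [set x | m2 (xsection A x) != 0%E].
Proof.
move=> mA; rewrite -[X in measurable X]setTI.
apply: emeasurable_neq => //; exact: measurable_fun_xsection.
Qed.

(** The product measure is by definition the integral of the measures of the sections, a nonnegative
    function. *)
Lemma product_measure_eq0P (A : set (T1 * T2)) : measurable A ->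
  (m1 \x m2)%E A = 0%E <-> m1 [set x | m2 (xsection A x) != 0%E] = 0%E.
Proof.
move=> mA; rewrite -[X in m1 X]setTI; apply: ge0_integral_eq0P => //.
exact: measurable_fun_xsection.
Qed.

End product_null.

(** * Null sets of finite powers, and their transfer to subgraphons *)

Section power_measure.
Context (R : realType) d (X : measurableType d).

Lemma weighted_eq0P (mu : probability X R) (f : weight mu) (B : set X) :
  measurable B -> weighted f B = 0%E <-> mu (B `&` [set x | f x != 0]) = 0%E.
Proof.
move=> mB.
have mf : measurable_fun setT (fun x => (f x)%:E).
  by apply/measurable_EFinP; exact: weight_meas.
have f0 x : (0 <= (f x)%:E)%E by rewrite lee_fin; case/andP: (weight_range f x).
(* A vanishing normalising constant would give [weighted f] total mass 0 instead of 1. *)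
have c0 : (fine (\int[mu]_x (f x)%:E))^-1 != 0.
  apply/eqP => c0; have := probability_setT (weighted f).
  by rewrite /= /weighted c0 mule0 => /esym/eqP; rewrite onee_eq0.
have -> : [set x | f x != 0] = [set x | (f x)%:E != 0%E].
  by apply/seteqP; split=> x /=; rewrite eqe.
apply: (iff_trans _ (ge0_integral_eq0P mu mB _ f0)).
  rewrite /weighted; split=> [/eqP|->]; last by rewrite mul0e.
  by rewrite mule_eq0 eqe (negbTE c0) orbF => /eqP.
exact: measurable_funS mf.
Qed.

Lemma tcons_sectionE n (A : set (n.+1.-tuple X)) (x : X) :
  [set t | A (tcons (x, t))] = xsection (@tcons _ X n @^-1` A) x.
Proof. by apply/seteqP; split=> t; rewrite /xsection /= inE. Qed.

Lemma measurable_tcons_preimage n (A : set (n.+1.-tuple X)) :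
  measurable A -> measurable (@tcons _ X n @^-1` A).
Proof. by move=> mA; rewrite -[X in measurable X]setTI; exact: measurable_tcons. Qed.

(** This is Fubini for null sets, pulled back along [tcons]. Measurability of the exceptional set is
    included since monotonicity of null sets asks for it. *)
Lemma power_measureS_eq0P (mu : probability X R) n (A : set (n.+1.-tuple X)) :
  measurable A ->
  measurable [set x | power_measure mu n [set t | A (tcons (x, t))] != 0%E] /\
  (power_measure mu n.+1 A = 0%E <->
   mu [set x | power_measure mu n [set t | A (tcons (x, t))] != 0%E] = 0%E).
Proof.
move=> /measurable_tcons_preimage mA.
under eq_fun do rewrite tcons_sectionE.
split; first exact: measurable_xsection_neq0.
exact: product_measure_eq0P.
Qed.

Lemma measurable_tcons_section n (A : set (n.+1.-tuple X)) (x : X) :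
  measurable A -> measurable [set t | A (tcons (x, t))].
Proof.
move=> /measurable_tcons_preimage mA; rewrite tcons_sectionE.
exact: measurable_xsection.
Qed.

Lemma measurable_all_tnth n (B : set X) : measurable B ->
  measurable [set t : n.-tuple X | forall i, B (tnth t i)].
Proof.
move=> mB.
have -> : [set t : n.-tuple X | forall i, B (tnth t i)] =
    \bigcap_(i in [set: 'I_n]) ((fun t : n.-tuple X => tnth t i) @^-1` B).
  by apply/seteqP; split=> t /= h i; [move=> _|]; apply: h.
apply: fin_bigcap_measurable => // i _; rewrite -[X in measurable X]setTI.
exact: measurable_tnth.
Qed.

Lemma measurable_weight_neq0 (mu : probability X R) (f : weight mu) :
  measurable [set x | f x != 0].
Proof.
rewrite -[X in measurable X]setTI.
have -> : [set x | f x != 0] = f @^-1` (~` [set 0]).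
  by apply/seteqP; split=> x /=; move/eqP.
by apply: weight_meas => //; exact: measurableC.
Qed.

(** The measure [weighted f] lives on the support of [f] and is absolutely continuous with respect
    to [mu]; Fubini carries this to powers one coordinate at a time. Its contrapositive turns a copy
    of a graph in the subgraphon into copies in [W] with all vertices in the support. *)
Lemma power_weighted_eq0 (mu : probability X R) (f : weight mu) n
    (A : set (n.-tuple X)) : measurable A ->
  power_measure mu n (A `&` [set t | forall i, f (tnth t i) != 0]) = 0%E ->
  power_measure (weighted f) n A = 0%E.
Proof.
have mS := measurable_weight_neq0 f.
elim: n A => [|n IHn] A mA.
  (* Both measures are the Dirac mass at the empty tuple, where the support condition is vacuous. *)
  congr (_ = _); congr dirac; apply/seteqP; split=> t //= At; first by case: At.
  by split=> // -[].
have mAS : measurable (A `&` [set t | forall i, f (tnth t i) != 0]).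
  by apply: measurableI => //; exact: measurable_all_tnth n.+1 _ mS.
have [mN muE] := power_measureS_eq0P mu mAS.
move=> /muE muN.
have [mM ->] := power_measureS_eq0P (weighted f) mA.
apply/weighted_eq0P => //.
apply: (subset_measure0 _ mN _ muN); first exact: measurableI.
(* For [x] in the support, a [mu]-null section of the restricted set would make the section of [A]
   null for [weighted f], by induction. *)
move=> x [/= /eqP Mx fx]; apply/eqP => Nx; apply: Mx; apply: IHn.
  exact: measurable_tcons_section.
rewrite -[RHS]Nx; congr (power_measure mu n _).
apply/seteqP; split=> t /= [At ft]; split=> // i.
  by case: (unliftP ord0 i) => [j|] ->; rewrite ?tnthS ?tnth0//; exact: ft.
by have := ft (lift ord0 i); rewrite tnthS.
Qed.

End power_measure.

Lemma nb_aut_gt0 (G : finite_graph) : (0 < nb_aut G)%N.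
Proof.
apply/card_gt0P; exists (perm_one G); rewrite inE.
by apply/forallP => v; apply/forallP => w; rewrite !perm1.
Qed.

(** * Induced densities of graphs on the vertex set ['I_n] *)

Section pattern.
Context (R : realType) d (X : measurableType d).
Variable W : X * X -> R.

(** Only the entries [e i j] with [i < j] matter; [pattern_adj] below symmetrizes
    them. *)
Definition pattern_factor n (e : rel 'I_n) (x : n.-tuple X) : R :=
  \prod_(i < n) \prod_(j < n | (i < j)%N)
    let w := W (tnth x i, tnth x j) in if e i j then w else 1 - w.

(** The pairs containing the vertex [ord0] form the first row of the double product; the other rows
    describe the graph with that vertex removed. *)
Lemma pattern_factor_tcons n (e : rel 'I_n.+1) (y : X) (t : n.-tuple X) :
  pattern_factor e (tcons (y, t)) =
  (\prod_(j < n) let w := W (y, tnth t j) in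
     if e ord0 (lift ord0 j) then w else 1 - w) *
  pattern_factor (fun i j => e (lift ord0 i) (lift ord0 j)) t.
Proof.
rewrite /pattern_factor big_ord_recl; congr (_ * _).
  rewrite big_mkcond big_ord_recl /= mul1r; apply: eq_bigr => j _.
  by rewrite tnth0 tnthS.
apply: eq_bigr => i _; rewrite big_mkcond big_ord_recl /= mul1r [RHS]big_mkcond.
by apply: eq_bigr => j _; rewrite !tnthS.
Qed.

Definition pattern_adj n (e : rel 'I_n) : rel 'I_n :=
  fun i j => ((i < j)%N && e i j) || ((j < i)%N && e j i).

Lemma pattern_adj_sym n (e : rel 'I_n) : symmetric (pattern_adj e).
Proof. by move=> i j; rewrite /pattern_adj orbC. Qed.

Lemma pattern_adj_irr n (e : rel 'I_n) : irreflexive (pattern_adj e).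
Proof. by move=> i; rewrite /pattern_adj ltnn. Qed.

Definition pattern_graph n (e : rel 'I_n) : finite_graph :=
  FiniteGraph (pattern_adj_sym e) (pattern_adj_irr e).

Hypothesis mW : measurable_fun setT W.
Hypothesis W01 : forall p, 0 <= W p <= 1.

Lemma measurable_pattern_factor n (e : rel 'I_n) :
  measurable_fun setT (pattern_factor e).
Proof.
apply: measurable_prod => i _.
under eq_fun do rewrite big_mkcond.
apply: measurable_prod => j _.
case: (i < j)%N; last exact: measurable_cst.
have mWij : measurable_fun setT
    (fun x : n.-tuple X => W (tnth x i, tnth x j)).
  apply: (measurableT_comp mW); apply/measurable_fun_pairP.
  by split; exact: measurable_tnth.
by case: (e i j) => //; exact: measurable_funB.
Qed.

Lemma pattern_factor_ge0 n (e : rel 'I_n) x : 0 <= pattern_factor e x.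
Proof.
apply: prodr_ge0 => i _; apply: prodr_ge0 => j _ /=.
by have /andP[] := W01 (tnth x i, tnth x j); case: ifP; rewrite ?subr_ge0.
Qed.

Lemma measurable_pattern_factor_neq0 n (e : rel 'I_n) :
  measurable [set x | pattern_factor e x != 0].
Proof.
rewrite -[X in measurable X]setTI.
have -> : [set x | pattern_factor e x != 0] =
    pattern_factor e @^-1` (~` [set 0]).
  by apply/seteqP; split=> x /=; move/eqP.
by apply: measurable_pattern_factor => //; exact: measurableC.
Qed.

Lemma integral_pattern_factor_eq0P (m : nat) (e : rel 'I_m)
    (mu : probability X R) :
  (\int[power_measure mu m]_x (pattern_factor e x)%:E = 0)%E <->
  power_measure mu m [set x | pattern_factor e x != 0] = 0%E.
Proof.
have -> : [set x | pattern_factor e x != 0] =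
    setT `&` [set x | (pattern_factor e x)%:E != 0%E].
  by rewrite setTI; apply/seteqP; split=> x /=; rewrite eqe.
apply: ge0_integral_eq0P => //.
  by apply/measurable_EFinP; exact: measurable_pattern_factor.
by move=> x; rewrite lee_fin pattern_factor_ge0.
Qed.

(** The combinatorial constant is nonzero, so only the integral of a nonnegative function can
    vanish. *)
Lemma phi_eq0P (mu : probability X R) (G : finite_graph) :
  phi mu W G = 0%E <-> power_measure mu #|G|
    [set x | pattern_factor (n := #|G|)
      (fun i j => adj (enum_val i : G) (enum_val j)) x != 0] = 0%E.
Proof.
apply: iff_trans (integral_pattern_factor_eq0P _ _).
have c0 : (#|G| `!%:R / (nb_aut G)%:R : R) != 0.
  by rewrite mulf_neq0 ?invr_eq0// pnatr_eq0 -lt0n ?fact_gt0 ?nb_aut_gt0.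
rewrite /phi; split=> [/eqP|I0]; last by rewrite [X in (_ * X)%E]I0 mule0.
by rewrite mule_eq0 eqe (negbTE c0) => /eqP.
Qed.

Lemma Q_phi_neq0 (mu : probability X R) (G : finite_graph) :
  Q mu W G <-> phi mu W G <> 0%E.
Proof.
rewrite /Q lt0e; split=> [/andP[/eqP]//|/eqP ->] /=.
apply: mule_ge0; first by rewrite lee_fin divr_ge0.
apply: integral_ge0 => x _; rewrite lee_fin; exact: pattern_factor_ge0.
Qed.

Lemma Q_pattern_graph (mu : probability X R) n (e : rel 'I_n) :
  Q mu W (pattern_graph e) <->
  power_measure mu n [set x | pattern_factor e x != 0] <> 0%E.
Proof.
apply: (iff_trans (Q_phi_neq0 _ _)).
suff H : phi mu W (pattern_graph e) = 0%E <->
    power_measure mu n [set x | pattern_factor e x != 0] = 0%E.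
  by split=> h h'; apply: h; apply/H.
apply: (iff_trans (phi_eq0P _ _)) => /=.
have -> : (fun i j : 'I_#|'I_n| => pattern_adj e (enum_val i) (enum_val j)) =
    (fun i j => pattern_adj e (cast_ord (card_ord n) i)
      (cast_ord (card_ord n) j)).
  by apply/funext => i; apply/funext => j; rewrite !enum_val_ord.
(* The cardinal [#|'I_n|] equals [n] only propositionally: once it is generalised to [m],
   eliminating the equation makes the casts trivial. *)
move: (card_ord n) e; move: #|'I_n| => m; case: n / => e.
suff -> : pattern_factor (fun i j => pattern_adj e (cast_ord erefl i)
    (cast_ord erefl j)) = pattern_factor e by [].
apply/funext => x; apply: eq_bigr => i _; apply: eq_bigr => j ij /=.
by rewrite !cast_ord_id /pattern_adj ij /= [(j < i)%N]ltnNge ltnW// orbF.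
Qed.

End pattern.

(** * The induction on the number of vertices *)

Theorem theorem6p2 (R : realType) (d : measure_display) (X : measurableType d)
    (mu : probability X R) (W : X * X -> R)
    (graphonW : is_graphon mu W)
    (wrW : weakly_random mu W)
    (exG : exists G : finite_graph, phi mu W G = 0%E) :
  \forall p \ae (mu \x mu)%E, W p = 0 \/ W p = 1.
Proof.
have [_ _ mW _ W01] := graphonW.
pose S := [set p | W p != 0] `&` [set p | W p != 1].
have mS : measurable S.
  have -> : S = W @^-1` ((~` [set 0]) `&` (~` [set 1])).
    by apply/seteqP; split=> p /= [/eqP ? /eqP ?].
  rewrite -[X in measurable X]setTI; apply: mW => //.
  by apply: measurableI; exact: measurableC.
have [S0|S0] := eqVneq ((mu \x mu)%E S) 0%E.
  exists S; split=> // p /= Wp; split; apply/eqP => Wp'; apply: Wp; tauto.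
have [G phiG] := exG; exfalso.
(* Quantifying over all relations on ['I_n] makes vertex removal a restriction of [e]; the
   enumeration of [G] is one instance. *)
suff H n (e : rel 'I_n) :
    power_measure mu n [set x | pattern_factor W e x != 0] <> 0%E.
  by move/(phi_eq0P mW W01): phiG; exact: H.
elim: n e => [|n IHn] e.
  rewrite [X in power_measure _ _ X](_ : _ = setT).
    rewrite probability_setT; exact/eqP/oner_neq0.
  by apply/seteqP; split=> // x _ /=; rewrite /pattern_factor big_ord0 oner_eq0.
have mF := measurable_pattern_factor_neq0 mW e.
have [mN ->] := power_measureS_eq0P mu mF => N0.
(* It remains to see that every [y] with a non-null section [S_y] is among the first coordinates
   that [N0] declares negligible. *)
move/eqP: S0; apply; apply/product_measure_eq0P => //.
apply: (subset_measure0 _ mN _ N0); first exact: measurable_xsection_neq0.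
move=> y /= /eqP Sy; apply/eqP => Ny.
have mSy : measurable (xsection S y) by exact: measurable_xsection.
have f_range x : 0 <= (\1_(xsection S y) x : R) <= 1.
  by rewrite indicE; case: (_ \in _); rewrite /= ?ler01 ?lexx.
have f_pos : (0 < \int[mu]_x ((\1_(xsection S y) x : R))%:E)%E.
  by rewrite integral_indic// setIT lt0e measure_ge0 andbT; apply/eqP.
have mf : measurable_fun setT (\1_(xsection S y) : X -> R).
  exact: measurable_indic.
pose f : weight mu := Weight mf f_range f_pos.
pose e' i j := e (lift ord0 i) (lift ord0 j).
have /(Q_pattern_graph mW W01) := (wrW f (pattern_graph e')).2
  ((Q_pattern_graph mW W01 mu e').2 (IHn e')).
(* Copies of [e'] with all vertices in [S_y] lie in the section at [y] of the copies of [e], which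
   [Ny] assumes null. *)
apply; apply: power_weighted_eq0; first exact: measurable_pattern_factor_neq0.
apply: (subset_measure0 _ _ _ Ny).
- apply: measurableI; first exact: measurable_pattern_factor_neq0.
  exact: measurable_all_tnth n _ (measurable_weight_neq0 f).
- exact: (measurable_tcons_section _ mF).
move=> t /= [Ft ft]; rewrite pattern_factor_tcons mulf_neq0//.
apply/prodf_neq0 => j _ /=; have := ft j; rewrite /= indicE.
case: (boolP (_ \in _)) => [|_]; last by rewrite eqxx.
rewrite /xsection /= inE => /set_mem[W0 W1] _.
by case: (e _ _); [exact: W0|rewrite subr_eq0 eq_sym; exact: W1].
Qed.
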